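(* Let $m,K\in\mathbb{N}$, let $a_i\in\mathbb{R}$, $b_i>0$, $L_i\le U_i$ for $i\in[m]$, let $\alpha_{ki}\ge 0$ and $\beta_k\in\mathbb{R}$ for $k\in[K]$, $i\in[m]$, and let $\theta>0$ be fixed. Consider the problem $$ \text{(A)}\quad \begin{aligned} \max_{\mathbf{u}\in\mathbb{R}^m,\ \mathbf{u}>0}\quad & -\theta+\sum_{i=1}^m\Bigl(\tfrac{a_i}{b_i}u_i-\tfrac{u_i\ln u_i}{b_i}-\theta u_i\Bigr)\\ \text{s.t.}\quad & \sum_{i=1}^m \tfrac{\alpha_{ki}}{b_i}\ln u_i\ \ge\ \sum_{i=1}^m\tfrac{\alpha_{ki}a_i}{b_i}-\beta_k,\qquad \forall k\in[K],\\ & e^{a_i-b_iU_i}\le u_i\le e^{a_i-b_iL_i},\qquad \forall i\in[m]. \end{aligned} $$ Then problem (A) is equivalent to the following exponential cone program: $$ \text{(B)}\quad \begin{aligned} \max_{\mathbf{u},\mathbf{s},\mathbf{v}\in\mathbb{R}^m}\quad & -\theta+\sum_{i=1}^m\Bigl(\tfrac{a_i}{b_i}u_i-\tfrac{1}{b_i}s_i-\theta u_i\Bigr)\\ \text{s.t.}\quad & \sum_{i=1}^m \tfrac{\alpha_{ki}}{b_i}v_i\ \ge\ \sum_{i=1}^m\tfrac{\alpha_{ki}a_i}{b_i}-\beta_k,\qquad \forall k\in[K],\\ & e^{a_i-b_iU_i}\le u_i\le e^{a_i-b_iL_i},\qquad \forall i\in[m],\\ & (-s_i,u_i,1)\in\mathcal{K}_{\exp},\qquad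 \forall i\in[m],\\ & (v_i,1,u_i)\in\mathcal{K}_{\exp},\qquad \forall i\in[m]. \end{aligned} $$
   Context: $[m]=\{1,\dots,m\}$. The exponential cone is $$\mathcal{K}_{\exp}=\{(x,y,z)\in\mathbb{R}^3: y>0,\ y e^{x/y}\le z\}\cup\{(x,0,z)\in\mathbb{R}^3: x\le 0,\ z\ge 0\}.$$ ''Equivalent'' has the usual meaning for optimization problems with auxiliary variables: the two problems have the same optimal value, and $\mathbf{u}$ is optimal for (A) if and only if there exist $\mathbf{s},\mathbf{v}$ such that $(\mathbf{u},\mathbf{s},\mathbf{v})$ is optimal for (B). *)

(* Defs.v *)
From mathcomp Require Import all_boot all_order all_algebra.
From mathcomp Require Import all_classical all_reals all_analysis.

Set Implicit Arguments.
Unset Strict Implicit.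
Unset Printing Implicit Defensive.

Import Order.TTheory GRing.Theory Num.Theory.

Local Open Scope classical_set_scope.
Local Open Scope ring_scope.

Record max_problem (R : realType) (T : Type) := MaxProblem {
  feasible : set T;
  objective : T -> R
}.

(* The value is extended real: -oo when infeasible, +oo when unbounded. *)
Definition optimal_value (R : realType) (T : Type) (P : max_problem R T) :
    \bar R :=
  ereal_sup [set (objective P x)%:E | x in feasible P].

Definition is_optimal (R : realType) (T : Type) (P : max_problem R T) (x : T) :
    Prop :=
  feasible P x /\ forall y, feasible P y -> objective P y <= objective P x.

(* W is the type of the auxiliary variables of the second problem. *)
Definition equivalent_with_aux (R : realType) (T W : Type)
    (P : max_problem R T) (Q : max_problem R (T * W)) : Prop :=
  optimal_value P = optimal_value Q /\
  forall x, is_optimal P x <-> exists w, is_optimal Q (x, w).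

Definition exp_cone (R : realType) : set (R * R * R) :=
  [set p | let: (x, y, z) := p in 0 < y /\ y * expR (x / y) <= z] `|`
  [set p | let: (x, y, z) := p in [/\ x <= 0, y = 0 & 0 <= z]].

Definition problemA (R : realType) (m K : nat) (a b L U : 'rV[R]_m)
    (alpha : 'M[R]_(K, m)) (beta : 'rV[R]_K) (theta : R) :
    max_problem R 'rV[R]_m :=
  {| feasible := [set u : 'rV[R]_m |
       [/\ forall i, 0 < u 0 i,
           forall k, \sum_(i < m) (alpha k i / b 0 i * ln (u 0 i))
             >= \sum_(i < m) (alpha k i * a 0 i / b 0 i) - beta 0 k
         & forall i, expR (a 0 i - b 0 i * U 0 i) <= u 0 i
             <= expR (a 0 i - b 0 i * L 0 i)]];
     objective := fun u : 'rV[R]_m =>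
       - theta + \sum_(i < m) (a 0 i / b 0 i * u 0 i
                               - u 0 i * ln (u 0 i) / b 0 i
                               - theta * u 0 i) |}.

Definition problemB (R : realType) (m K : nat) (a b L U : 'rV[R]_m)
    (alpha : 'M[R]_(K, m)) (beta : 'rV[R]_K) (theta : R) :
    max_problem R ('rV[R]_m * ('rV[R]_m * 'rV[R]_m)) :=
  {| feasible := [set w : 'rV[R]_m * ('rV[R]_m * 'rV[R]_m) |
       let: (u, (s, v)) := w in
       [/\ forall k, \sum_(i < m) (alpha k i / b 0 i * v 0 i)
             >= \sum_(i < m) (alpha k i * a 0 i / b 0 i) - beta 0 k,
           forall i, expR (a 0 i - b 0 i * U 0 i) <= u 0 i
             <= expR (a 0 i - b 0 i * L 0 i),
           forall i, exp_cone (- s 0 i, u 0 i, 1)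
         & forall i, exp_cone (v 0 i, 1, u 0 i)]];
     objective := fun w : 'rV[R]_m * ('rV[R]_m * 'rV[R]_m) =>
       let: (u, (s, v)) := w in
       - theta + \sum_(i < m) (a 0 i / b 0 i * u 0 i
                               - 1 / b 0 i * s 0 i
                               - theta * u 0 i) |}.

(* Main.v *)
Require Import Defs.
From mathcomp Require Import all_boot all_order all_algebra.
From mathcomp Require Import all_classical all_reals all_analysis.

Import Order.TTheory GRing.Theory Num.Theory.

Local Open Scope ring_scope.

(** For fixed [u > 0] the two cone constraints of the conic program decouple
    into [u_i ln u_i <= s_i] and [v_i <= ln u_i] ([exp_cone_entropy] and
    [exp_cone_log]): [s] bounds the entropy term from above and [v] bounds the
    logarithm from below.  In the conic program positivity of [u] comes from the
    box constraint, which bounds [u_i] below by an exponential.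

    The signs all point the same way.  As [b_i > 0], a larger [s_i] can only
    lower the objective; as [alpha_ki / b_i >= 0], a smaller [v_i] can only make
    the linear constraints harder.  Hence every point [(u, s, v)] of the conic
    program projects to a feasible [u] of at least the same value, while the
    tight choice [s_i = u_i ln u_i], [v_i = ln u_i] lifts every feasible [u]
    without changing its value.  Such a projection and lift suffice for the
    equivalence of two maximization problems
    ([equivalent_with_aux_of_lift]). *)

(** Values can only grow under projection and are kept by the lift, so the two
    sets of values dominate each other.  An optimal [(x, w)] need not be
    [(x, lift x)], but [x] is then optimal because its value lies above that of
    [(x, w)], which bounds the value of every lifted point. *)
Lemma equivalent_with_aux_of_lift (R : realType) (T W : Type)
    (P : max_problem R T) (Q : max_problem R (T * W)) (lift : T -> W)
    (feasible_lift : forall x, feasible P x -> feasible Q (x, lift x))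
    (objective_lift : forall x, feasible P x ->
       objective Q (x, lift x) = objective P x)
    (feasible_proj : forall x w, feasible Q (x, w) -> feasible P x)
    (objective_proj : forall x w, feasible Q (x, w) ->
       objective Q (x, w) <= objective P x) :
  equivalent_with_aux P Q.
Proof.
split.
  apply/eqP; rewrite eq_le; apply/andP; split; apply: ge_ereal_sup.
    move=> _ [x Px <-]; apply: ereal_sup_ubound.
    by exists (x, lift x); [exact: feasible_lift | rewrite objective_lift].
  move=> _ [[x w] Qxw <-]; have Px := feasible_proj _ _ Qxw.
  apply: (@le_trans _ _ (objective P x)%:E).
    by rewrite lee_fin objective_proj.
  by apply: ereal_sup_ubound; exists x.
move=> x; split=> [[Px xmax]|[w [Qxw wmax]]].
  exists (lift x); split=> [|[y w] Qyw]; first exact: feasible_lift.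
  rewrite objective_lift //; apply: le_trans (objective_proj _ _ Qyw) _.
  exact/xmax/feasible_proj/Qyw.
split=> [|y Py]; first exact: feasible_proj Qxw.
rewrite -objective_lift //; apply: le_trans (objective_proj _ _ Qxw).
exact/wmax/feasible_lift.
Qed.

(** Since [u > 0], only the first piece of the cone matters; there the
    condition [u * e^(-s/u) <= 1] becomes [- s/u <= - ln u] by taking
    logarithms. *)
Lemma exp_cone_entropy (R : realType) (s u : R) :
  0 < u -> exp_cone (- s, u, 1) <-> u * ln u <= s.
Proof.
move=> u_gt0.
have -> : (u * ln u <= s) = (u * expR (- s / u) <= 1).
  rewrite -[RHS]ler_pdivlMl // mulr1 -[X in expR _ <= X]lnK.
    by rewrite ler_expR lnV // mulNr lerN2 ler_pdivlMr // mulrC.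
  by rewrite posrE invr_gt0.
split=> [[[]//|[_ u0 _]]|le1]; last by left.
by rewrite u0 ltxx in u_gt0.
Qed.

Lemma exp_cone_log (R : realType) (v u : R) :
  0 < u -> exp_cone (v, 1, u) <-> v <= ln u.
Proof.
move=> u_gt0.
have -> : (v <= ln u) = (1 * expR (v / 1) <= u).
  by rewrite divr1 mul1r -[u in RHS]lnK // ler_expR.
split=> [[[]//|[_ /eqP]]|le_u]; first by rewrite oner_eq0.
by left.
Qed.

Theorem proposition1 (R : realType) (m K : nat) (a b L U : 'rV[R]_m)
    (alpha : 'M[R]_(K, m)) (beta : 'rV[R]_K) (theta : R)
    (b_gt0 : forall i, 0 < b 0 i)
    (leLU : forall i, L 0 i <= U 0 i)
    (alpha_ge0 : forall k i, 0 <= alpha k i)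
    (theta_gt0 : 0 < theta) :
  equivalent_with_aux (problemA a b L U alpha beta theta)
                      (problemB a b L U alpha beta theta).
Proof.
have box_gt0 (u : 'rV[R]_m) :
    (forall i, expR (a 0 i - b 0 i * U 0 i) <= u 0 i
       <= expR (a 0 i - b 0 i * L 0 i)) -> forall i, 0 < u 0 i.
  by move=> box i; case/andP: (box i) => + _; apply: lt_le_trans (expR_gt0 _).
apply: (@equivalent_with_aux_of_lift _ _ _ _ _ (fun u : 'rV[R]_m =>
  (\row_i (u 0 i * ln (u 0 i)), \row_i ln (u 0 i)))).
- move=> u [u_gt0 lin box]; split=> [k|//|i|i].
  + by under [leRHS]eq_bigr do rewrite mxE; exact: lin.
  + by rewrite mxE; apply/exp_cone_entropy.
  + by rewrite mxE; apply/exp_cone_log.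
- move=> u _ /=; congr (_ + _); apply: eq_bigr => i _.
  by rewrite mxE mul1r [_^-1 * _]mulrC.
- move=> u [s v] [lin box _ cone_v].
  have u_gt0 := box_gt0 _ box; split=> // k.
  apply: le_trans (lin k) _; apply: ler_sum => i _.
  apply: ler_wpM2l; first by rewrite divr_ge0 // ltW.
  exact/exp_cone_log.
- move=> u [s v] [_ box cone_s _] /=.
  rewrite lerD2l; apply: ler_sum => i _.
  rewrite lerD2r lerD2l lerN2 mul1r [_^-1 * _]mulrC.
  apply: ler_wpM2r; first by rewrite invr_ge0 ltW.
  by apply/exp_cone_entropy; first exact: box_gt0.
Qed.
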